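(* Let $f:\mathbb{R}^n\to\mathbb{R}$ be convex and differentiable with $L$-Lipschitz continuous gradient, $L>0$, let $\rho>0$, let $F(x)=f(x)+\rho\|x\|_1$, and suppose that $F^*=\inf_{x\in\mathbb{R}^n}F(x)>-\infty$ and that $X^*=\{x\in\mathbb{R}^n:F(x)=F^*\}$ is nonempty. Let $h^*\in\mathbb{R}^n$ be the vector such that $\nabla f(x^* )=h^*$ for all $x^*\in X^*$, and let $E=\{i:|h_i^*|=\rho\}$. Define $\phi:\mathbb{R}^{|E|}\to\mathbb{R}$ by $$\phi(x_E)=-(h_E^* )^\top x_E+f\big((x_E,0)\big),$$ and $$O_E=\{v\in\mathbb{R}^{|E|}:-\operatorname{sgn}(h^*_{E(j)})\,v_j\ge0\ \ \forall j\in\{1,2,\dots,|E|\}\}.$$ Let $x^0,x^1\in\mathbb{R}^n$ and, for all $k\in\mathbb{N}$, let $$y^{k+1}=x^k+\alpha_k(x^k-x^{k-1}),\qquad x^{k+1}=\operatorname{prox}_{\lambda_k\rho\|\cdot\|_1}\big(y^{k+1}-\lambda_k\nabla f(y^{k+1})\big),$$ where either 1. $\{\lambda_k\}_{k\in\mathbb{N}}$ is nondecreasing, $0<\lambda_k\le 1/L$ and $0\le\alpha_k\le\overline{\alpha}<1$ for all $k\in\mathbb{N}$ (with $\overline{\alpha}$ independent of $k$); or 2. $x^1=x^0$, and there are constants $\lambda\in(0,1/L]$ and $a>2$ such that $\lambda_k=\lambda$ and $\alpha_k=\frac{k-1}{k+a}$ for all $k\in\mathbb{N}$. Then, for all but finitely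 many $k$, $$x_E^{k+1}=P_{O_E}\big(y_E^{k+1}-\lambda_k\nabla\phi(y_E^{k+1})\big)\qquad\text{and}\qquad F(x^k)=\phi(x_E^k),$$ where $P_{O_E}$ is the orthogonal projector onto $O_E$.
   Context: $\mathbb{N}=\{1,2,\dots\}$. $\operatorname{prox}_g(y)=\arg\min_{x}\{\tfrac12\|x-y\|^2+g(x)\}$. $\operatorname{sgn}(c)=+1$ if $c\ge0$ and $-1$ if $c<0$. The elements of $E\subseteq\{1,\dots,n\}$ are listed in increasing order, $E(j)$ being the $j$th element. For $v\in\mathbb{R}^n$, $v_E\in\mathbb{R}^{|E|}$ is the vector with entries $v_{E(j)}$, and $(v_E,0)\in\mathbb{R}^n$ is the vector whose $i$th entry is $v_i$ if $i\in E$ and $0$ otherwise. Under the stated assumptions $\nabla f$ is constant on $X^*$, so $h^*$ is well defined, and $|h_i^*|\le\rho$ for every $i$. *)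

(* Defs.v *)
From mathcomp Require Export all_boot all_order all_algebra.
From mathcomp Require Export all_classical all_reals all_analysis.
Export Order.TTheory GRing.Theory Num.Theory.
Export numFieldNormedType.Exports.

Set Implicit Arguments.
Unset Strict Implicit.
Unset Printing Implicit Defensive.

Local Open Scope classical_set_scope.
Local Open Scope ring_scope.

Definition dot (R : realType) (n : nat) (u v : 'rV[R]_n) : R :=
  \sum_i u 0 i * v 0 i.

(* The library norm `|v| on row vectors is the sup norm, hence this one. *)
Definition norm2 (R : realType) (n : nat) (v : 'rV[R]_n) : R :=
  Num.sqrt (dot v v).

Definition norm1 (R : realType) (n : nat) (v : 'rV[R]_n) : R :=
  \sum_i `|v 0 i|.

(* Meaningful at points where f is differentiable: then
   'd f x v = dot (grad f x) v. *)
Definition grad (R : realType) (n : nat) (f : 'rV[R]_n -> R) (x : 'rV[R]_n) :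
    'rV[R]_n :=
  \row_i 'D_(delta_mx 0 i) f x.

(* A minimizer of G over A; arbitrary when there is none. It is used below only
   for G strongly convex (prox) or the distance to a point (proj), where the
   minimizer over a nonempty closed convex A exists and is unique. *)
Definition argmin (R : realType) (n : nat) (A : set 'rV[R]_n)
    (G : 'rV[R]_n -> R) : 'rV[R]_n :=
  get [set x | A x /\ forall z, A z -> G x <= G z].

Definition prox (R : realType) (n : nat) (g : 'rV[R]_n -> R) (y : 'rV[R]_n) :
    'rV[R]_n :=
  argmin setT (fun x => 2^-1 * norm2 (x - y) ^+ 2 + g x).

Definition proj (R : realType) (n : nat) (A : set 'rV[R]_n) (y : 'rV[R]_n) :
    'rV[R]_n :=
  argmin A (fun x => norm2 (x - y)).

Definition objective (R : realType) (n : nat) (f : 'rV[R]_n -> R) (rho : R)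
    (x : 'rV[R]_n) : R :=
  f x + rho * norm1 x.

Definition optval (R : realType) (n : nat) (f : 'rV[R]_n -> R) (rho : R) :
    \bar R :=
  ereal_inf (range (fun x => (objective f rho x)%:E)).

Definition optset (R : realType) (n : nat) (f : 'rV[R]_n -> R) (rho : R) :
    set 'rV[R]_n :=
  [set x | (objective f rho x)%:E = optval f rho].

(* Num.sg is not suitable: it vanishes at 0. *)
Definition sgn (R : realType) (c : R) : R := if 0 <= c then 1 else -1.

Definition active (R : realType) (n : nat) (h : 'rV[R]_n) (rho : R) :
    {set 'I_n} :=
  [set i | `|h 0 i| == rho]%SET.

(* v_E; enum_val lists the elements of E : {set 'I_n} in increasing order. *)
Definition restr (R : realType) (n : nat) (E : {set 'I_n}) (v : 'rV[R]_n) :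
    'rV[R]_#|E| :=
  \row_j v 0 (enum_val j).

(* (w, 0): the i-th entry is w_j if i is the j-th element of E, and 0 if i is
   not in E (the sum has at most one term). *)
Definition ext0 (R : realType) (n : nat) (E : {set 'I_n}) (w : 'rV[R]_#|E|) :
    'rV[R]_n :=
  \row_i \sum_(j < #|E| | enum_val j == i) w 0 j.

Definition phi (R : realType) (n : nat) (f : 'rV[R]_n -> R) (h : 'rV[R]_n)
    (E : {set 'I_n}) (w : 'rV[R]_#|E|) : R :=
  - dot (restr E h) w + f (ext0 w).

Definition orthant (R : realType) (n : nat) (h : 'rV[R]_n) (E : {set 'I_n}) :
    set 'rV[R]_#|E| :=
  [set v | forall j, 0 <= - sgn (restr E h 0 j) * v 0 j].
Arguments orthant {R n} h E.

(* Main.v *)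
Require Import Defs.
From mathcomp Require Import ring lra.

(* The prox is coordinatewise soft thresholding, and one step from [y] to [x+]
   satisfies, for every [z],
     [2 lam F x+ + |x+ - z|^2 <= 2 lam F z + |y - z|^2].
   Fix a minimizer [xs] and put [h = grad f xs].  The optimality conditions
   [|h_i| <= rho], [rho |xs_i| + h_i xs_i = 0] and cocoercivity of the gradient
   give
     [F x - F xs >= sum_i (rho |x_i| + h_i x_i) + |grad f x - h|^2 / (2 L)],
   with all summands nonnegative.  Hence convergence of the iterates is not
   needed: [F x_k -> F xs] and [x_{k+1} - x_k -> 0] already force
   [grad f y_k -> h], [x_k,i -> 0] off [E], and the wrong-signed part of [x_k,i]
   to vanish on [E], so that the thresholding eventually returns [0] off [E] and
   acts on [E] as the projection onto a half-line.
   These two limits follow from boundedness of the iterates and summability of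
   [|x_{k+1} - x_k|^2] (case 1, by an Alvarez-Attouch argument), respectively
   from [|x_{k+1} - x_k| = O(1/k)] (case 2, by the Chambolle-Dossal energy). *)

Set Implicit Arguments.
Unset Strict Implicit.
Unset Printing Implicit Defensive.

Local Open Scope classical_set_scope.
Local Open Scope ring_scope.

(** * Inner product algebra and Young's inequality *)

Section Dot.
Context {R : realType} {n : nat}.
Implicit Types u v w : 'rV[R]_n.

Lemma dotC u v : dot u v = dot v u.
Proof. by apply: eq_bigr => i _; rewrite mulrC. Qed.

Lemma dotDl u v w : dot (u + v) w = dot u w + dot v w.
Proof. by rewrite -big_split; apply: eq_bigr => i _; rewrite mxE mulrDl. Qed.

Lemma dotZl a u v : dot (a *: u) v = a * dot u v.
Proof. by rewrite big_distrr; apply: eq_bigr => i _; rewrite mxE -mulrA. Qed.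

Lemma dotNl u v : dot (- u) v = - dot u v.
Proof. by rewrite -scaleN1r dotZl mulN1r. Qed.

Lemma dotDr u v w : dot u (v + w) = dot u v + dot u w.
Proof. by rewrite dotC dotDl !(dotC u). Qed.

Lemma dotZr a u v : dot u (a *: v) = a * dot u v.
Proof. by rewrite dotC dotZl dotC. Qed.

Lemma dotNr u v : dot u (- v) = - dot u v.
Proof. by rewrite dotC dotNl dotC. Qed.

Definition dotE := (dotDl, dotDr, dotNl, dotNr, dotZl, dotZr).

Lemma dot_ge0 u : 0 <= dot u u.
Proof. by apply: sumr_ge0 => i _; rewrite -expr2 sqr_ge0. Qed.

(** Expand [|e u - v|^2 >= 0] and divide by [e]. *)
Lemma dot_young e u v : 0 < e ->
  2 * dot u v <= e * dot u u + e^-1 * dot v v.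
Proof.
move=> e0; have := dot_ge0 (e *: u - v).
rewrite !dotE (dotC v u) -(pmulr_rge0 _ (_ : 0 < e^-1)) ?invr_gt0 //.
set a := (X in 0 <= X -> _) => a0; rewrite -subr_ge0.
suff -> : e * dot u u + e^-1 * dot v v - 2 * dot u v = a by [].
by rewrite /a; field; rewrite gt_eqF.
Qed.

Lemma norm2_sqr u : norm2 u ^+ 2 = dot u u.
Proof. by rewrite sqr_sqrtr ?dot_ge0. Qed.

Lemma dot_delta u i : dot u (delta_mx 0 i) = u 0 i.
Proof.
rewrite /dot (bigD1 i) //= mxE !eqxx mulr1 big1 ?addr0 // => j /negPf ij.
by rewrite mxE eqxx ij mulr0.
Qed.

Lemma coordB u v i : (u - v) 0 i = u 0 i - v 0 i.
Proof. by rewrite !mxE. Qed.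

Lemma coordZ a u i : (a *: u) 0 i = a * u 0 i.
Proof. by rewrite mxE. Qed.

Lemma sqr_coord_le_dot u i : u 0 i ^+ 2 <= dot u u.
Proof.
rewrite /dot (bigD1 i) //= -expr2 lerDl.
by apply: sumr_ge0 => j _; rewrite -expr2 sqr_ge0.
Qed.

Lemma dot_le0_eq u v : dot (u - v) (u - v) <= 0 -> u = v.
Proof.
move=> d0; apply/rowP => i; apply/eqP; rewrite -subr_eq0 -sqrf_eq0.
have := le_trans (sqr_coord_le_dot (u - v) i) d0; rewrite !mxE.
by rewrite eq_le sqr_ge0 andbT.
Qed.

End Dot.

(** * Tangent inequality and descent lemma for [f] *)

Section Gradient.
Context {R : realType} {n : nat}.
Variable f : 'rV[R]_n -> R.
Hypothesis f_diff : forall x, differentiable f x.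
Implicit Types u v w x z : 'rV[R]_n.

Lemma derive_dot_grad x v : 'D_v f x = dot (grad f x) v.
Proof.
rewrite deriveE // {1}[v]row_sum_delta linear_sum; apply: eq_bigr => i _.
by rewrite linearZ /= mxE -deriveE // mulrC.
Qed.

Lemma is_derive_line x v (t : R) :
  is_derive t 1 (fun s : R => f (x + s *: v)) (dot (grad f (x + t *: v)) v).
Proof.
have E : (fun h : R => h^-1 *: (((fun s => f (x + s *: v)) \o shift t) (h *: 1)
    - f (x + t *: v))) =
  (fun h => h^-1 *: ((f \o shift (x + t *: v)) (h *: v) - f (x + t *: v))).
  apply/funext => h /=; congr (_ *: (f _ - _)).
  by rewrite -[h *: 1]/(h * 1) mulr1 scalerDl addrCA.
apply: DeriveDef.
  by rewrite /derivable E; exact: diff_derivable.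
by rewrite /derive E -derive_dot_grad.
Qed.

(** By convexity the difference quotient along [z - x] with step [h] in [(0, 1]] is at most
    [f z - f x]; the bound survives the limit [h -> 0+]. *)
Lemma convex_above_tangent : convex_function setT f ->
  forall x z, f x + dot (grad f x) (z - x) <= f z.
Proof.
move=> f_convex x z; rewrite -derive_dot_grad addrC -lerBrDr.
have c : (fun h : R => h^-1 *: ((f \o shift x) (h *: (z - x)) - f x)) @ 0^'+ -->
    'D_(z - x) f x.
  by apply: cvg_dnbhs_at_right; exact: diff_derivable.
apply: (cvgr_to_le c); near=> h.
have h0 : 0 < h by [].
have h1 : h <= 1 by near: h; exact: nbhs_right_le.
have := f_convex (Itv01 (ltW h0) h1) z x (in_setT _) (in_setT _).
rewrite convRE /conv /= /unstable.onem => fle.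
rewrite -[_ *: _]/(h^-1 * _) mulrC ler_pdivrMr //.
rewrite (_ : h *: (z - x) + x = h *: z + (1 - h) *: x); first by lra.
by rewrite scalerBr scalerBl scale1r addrAC addrA.
Unshelve. all: by end_near.
Qed.

(** After subtraction of the linear part and of the parabola [d s^2], the mean value theorem on
    [[0, 1]] reduces the claim to a bound on the slope at one point [s]. *)
Lemma descent (L : R) : 0 < L ->
  (forall x y, norm2 (grad f x - grad f y) <= L * norm2 (x - y)) ->
  forall x v, f (x + v) <= f x + dot (grad f x) v + L / 2 * dot v v.
Proof.
move=> L0 f_lip x v.
pose c := dot (grad f x) v; pose d := L / 2 * dot v v.
pose g : R -> R := (fun s : R => f (x + s *: v)) - c *: id - d *: (id ^+ 2).
have gE t : g t = f (x + t *: v) - c * t - d * t ^+ 2 by [].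
have g' (t : R) :
    is_derive t 1 g (dot (grad f (x + t *: v)) v - c - d * (2 * t)).
  have ? := is_derive_line x v t.
  apply: is_derive_eq; rewrite /= expr1.
  by rewrite -[c%:A]/(c * 1) -[d *: _]/(d * (2 * t * 1)) !mulr1.
have gc : continuous g.
  by move=> t; apply: differentiable_continuous; apply/derivable1_diffP; have [] := g' t.
have [|s] := MVT ltr01 (fun t _ => g' t); first exact: continuous_subspaceT.
rewrite in_itv /= => /andP[s0 _]; rewrite !gE scale0r addr0 scale1r subr0.
rewrite expr1n expr0n !mulr0 !mulr1 !subr0 /=.
move=> fE.
suff le_dv : dot (grad f (x + s *: v)) v - c <= d * (2 * s).
  by rewrite -/c -/d; lra.
have Ls0 : 0 < L * s by rewrite mulr_gt0.
have lip : dot (grad f (x + s *: v) - grad f x) (grad f (x + s *: v) - grad f x)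
    <= (L * s) ^+ 2 * dot v v.
  have := f_lip (x + s *: v) x; rewrite [x + _ - x]addrAC subrr add0r => lip.
  rewrite -norm2_sqr (le_trans (lerXn2r 2 _ _ lip)) ?nnegrE ?sqrtr_ge0 //.
    by rewrite mulr_ge0 ?sqrtr_ge0 ?ltW.
  by rewrite exprMn norm2_sqr !dotE; lra.
have -> : dot (grad f (x + s *: v)) v - c = dot (grad f (x + s *: v) - grad f x) v.
  by rewrite dotDl dotNl.
move: (grad f _ - grad f _) lip => u lip; rewrite -(ler_pM2l Ls0).
(* Expanding this square and using [|u| <= L s |v|] gives [<u, v> <= L s |v|^2]. *)
have := dot_ge0 (u - (L * s) *: v); rewrite !dotE (dotC v u) /d.
by move: lip; nra.
Qed.

End Gradient.

(** * Scalar soft thresholding *)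

Section SoftThreshold.
Context {R : realType}.
Implicit Types t w z : R.

Definition soft t w : R :=
  if t < w then w - t else if w < - t then w + t else 0.

(** The function minimized is 1-strongly convex, so its value at [z] exceeds the minimum by half the
    squared distance. This extra square gives uniqueness of the prox and the distance term of the
    step inequality. *)
Lemma soft_min t w z : 0 <= t ->
  2^-1 * (soft t w - w) ^+ 2 + t * `|soft t w| + 2^-1 * (z - soft t w) ^+ 2
  <= 2^-1 * (z - w) ^+ 2 + t * `|z|.
Proof.
move=> t0; rewrite /soft.
have [zl zr] : z <= `|z| /\ - z <= `|z| by split; rewrite ?ler_norm // -normrN ler_norm.
have [tw|wt] := ltP t w.
  by rewrite gtr0_norm ?subr_gt0 //; nra.
have [wt'|tw] := ltP w (- t).
  by rewrite ltr0_norm; [nra|lra].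
rewrite normr0; have [z0|z0] := leP 0 z; nra.
Qed.

(** With [w] as a scaled gradient, the fixed point equation says that [- w] is a subgradient of
    [t |.|] at [z]. *)
Lemma soft_fix t w z : 0 <= t -> soft t (z - w) = z ->
  `|w| <= t /\ t * `|z| + w * z = 0.
Proof.
move=> t0; rewrite /soft; case: ltP => [h e|h].
  have z0 : 0 < z by lra.
  by rewrite (gtr0_norm z0) ler_norml; split; [apply/andP; lra|nra].
case: ltP => [h' e|h' z0].
  have z0 : z < 0 by lra.
  by rewrite (ltr0_norm z0) ler_norml; split; [apply/andP; lra|nra].
by rewrite -z0 normr0 !mulr0 addr0 ler_norml; split=> //; apply/andP; lra.
Qed.

End SoftThreshold.

(** * The prox of the l1 norm *)

Section Prox.
Context {R : realType} {n : nat}.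
Implicit Types y z : 'rV[R]_n.

Definition softv (t : R) y : 'rV[R]_n := \row_i soft t (y 0 i).

Lemma softv_min t y z : 0 <= t ->
  2^-1 * norm2 (softv t y - y) ^+ 2 + t * norm1 (softv t y)
    + 2^-1 * norm2 (z - softv t y) ^+ 2
  <= 2^-1 * norm2 (z - y) ^+ 2 + t * norm1 z.
Proof.
move=> t0; rewrite !norm2_sqr /norm1 /dot !big_distrr -!big_split /=.
by apply: ler_sum => i _; rewrite !mxE -!expr2; exact: soft_min.
Qed.

Lemma prox_norm1 t y : 0 <= t -> prox (fun z => t * norm1 z) y = softv t y.
Proof.
move=> t0; apply: get_unique => [|z [_ /(_ (softv t y) I) z_min]].
  split=> // z _; apply: le_trans (softv_min y z t0).
  by rewrite lerDl mulr_ge0 ?invr_ge0 ?exprn_ge0 ?sqrtr_ge0.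
have := softv_min y z t0; rewrite (norm2_sqr (z - softv t y)) => s_min.
by apply: dot_le0_eq; lra.
Qed.

End Prox.

(** * One forward-backward step, and growth of the objective around a minimizer *)

Section ForwardBackward.
Context {R : realType} {n : nat}.
Variables (f : 'rV[R]_n -> R) (L rho : R).
Hypothesis f_convex : convex_function setT f.
Hypothesis f_diff : forall x, differentiable f x.
Hypothesis L_gt0 : 0 < L.
Hypothesis f_lip :
  forall x y, norm2 (grad f x - grad f y) <= L * norm2 (x - y).
Hypothesis rho_gt0 : 0 < rho.
Implicit Types x y z : 'rV[R]_n.

Let F := objective f rho.

Definition fb (lam : R) y := softv (lam * rho) (y - lam *: grad f y).

(** Sum of the prox inequality, the tangent inequality at [y] toward [z] and the descent lemma from
    [y] to the new point, the last two scaled by [lam]; [lam L <= 1] absorbs the quadratic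
    remainder. *)
Lemma fb_ineq lam y z : 0 < lam <= 1 / L ->
  2 * lam * F (fb lam y) + dot (fb lam y - z) (fb lam y - z)
  <= 2 * lam * F z + dot (y - z) (y - z).
Proof.
move=> /andP[lam0]; rewrite ler_pdivlMr // => lamL.
have := softv_min (y - lam *: grad f y) z (ltW (mulr_gt0 lam0 rho_gt0)).
rewrite -/(fb lam y) !norm2_sqr; set s := fb lam y.
have [p ->] : exists p, s = y + p by exists (s - y); rewrite addrC subrK.
have [q ->] : exists q, z = y + q by exists (z - y); rewrite addrC subrK.
have := descent f_diff L_gt0 f_lip y p.
have := convex_above_tangent f_diff f_convex y (y + q).
have subD v w : y + v - (y + w) = v - w by rewrite opprD addrACA subrr add0r.
have -> : y + q - y = q by rewrite addrAC subrr add0r.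
have -> : y - (y + q) = - q by rewrite opprD addNKr.
rewrite !subD /F /objective.
move: (grad f y) (f (y + p)) (f y) (f (y + q)) (norm1 _) (norm1 _).
move=> g fs fy fz ns nz; rewrite !dotE (dotC q p) (dotC p g) (dotC q g).
move=> /(ler_wpM2l (ltW lam0)) tangent /(ler_wpM2l (ltW lam0)) desc.
have := ler_wpM2r (dot_ge0 p) lamL.
move: tangent desc; lra.
Qed.

(** Compare at [x - d / L]: the tangent at [z] bounds [f] there from below, the descent lemma at [x]
    from above. *)
Lemma cocoercive x z :
  f z + dot (grad f z) (x - z)
    + (2 * L)^-1 * dot (grad f x - grad f z) (grad f x - grad f z) <= f x.
Proof.
set d := grad f x - grad f z.
have := descent f_diff L_gt0 f_lip x (- (L^-1 *: d)).
have := convex_above_tangent f_diff f_convex z (x - L^-1 *: d).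
have -> : grad f x = d + grad f z by rewrite /d subrK.
move: d (grad f z) => d g; rewrite !dotE (dotC g d) => tangent desc.
suff -> : (2 * L)^-1 * dot d d =
  L^-1 * dot d d - L / 2 * (L^-1 * (L^-1 * dot d d)) by move: tangent desc; lra.
by field; rewrite gt_eqF.
Qed.

Lemma optset_minimizes z x : optset f rho z -> F z <= F x.
Proof.
by move=> zP; rewrite -lee_fin zP; apply: ereal_inf_lbound; exists x.
Qed.

Variable xs : 'rV[R]_n.
Hypothesis xs_min : forall x, F xs <= F x.
Let h := grad f xs.

(** The step inequality with [y] and [z] both equal to [xs] leaves no room for a displacement. *)
Lemma minimizer_fb : fb L^-1 xs = xs.
Proof.
apply: dot_le0_eq; have := @fb_ineq L^-1 xs xs.
rewrite mul1r invr_gt0 L_gt0 lexx subrr /(dot 0 0) big1; last first.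
  by move=> i _; rewrite mxE mul0r.
move=> /(_ isT); have := xs_min (fb L^-1 xs).
have : 0 < 2 * L^-1 by rewrite mulr_gt0 ?invr_gt0.
by move=> c0 /(ler_wpM2l (ltW c0)); lra.
Qed.

Lemma minimizer_kkt i :
  `|h 0 i| <= rho /\ rho * `|xs 0 i| + h 0 i * xs 0 i = 0.
Proof.
have Li : 0 < L^-1 by rewrite invr_gt0.
have := congr1 (fun v : 'rV_n => v 0 i) minimizer_fb.
rewrite !mxE => /soft_fix[|].
  by rewrite mulr_ge0 ?ltW.
rewrite normrM gtr0_norm // ler_pM2l // -/h => hi; rewrite -!mulrA -mulrDr.
by move/eqP; rewrite mulf_eq0 gt_eqF //= => /eqP.
Qed.

Lemma gap_term_ge0 x i : 0 <= rho * `|x 0 i| + h 0 i * x 0 i.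
Proof.
have [hi _] := minimizer_kkt i.
have := ler_wpM2r (normr_ge0 (x 0 i)) hi; rewrite -normrM.
by have := ler_norm (- (h 0 i * x 0 i)); rewrite normrN; lra.
Qed.

(** Cocoercivity between [x] and [xs], combined with [rho |xs|_1 + <h, xs> = 0]. *)
Lemma gap_ge x :
  \sum_i (rho * `|x 0 i| + h 0 i * x 0 i)
    + (2 * L)^-1 * dot (grad f x - h) (grad f x - h) <= F x - F xs.
Proof.
have := cocoercive x xs; rewrite -/h dotDr dotNr.
have : rho * norm1 xs + dot h xs = 0.
  rewrite /norm1 /dot big_distrr -big_split big1 //= => i _.
  by have [] := minimizer_kkt i.
rewrite big_split /= -mulr_sumr -/(norm1 x) -/(dot h x) /F /objective.
by lra.
Qed.

Lemma gap_ge_coord x i : rho * `|x 0 i| + h 0 i * x 0 i <= F x - F xs.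
Proof.
apply: le_trans (gap_ge x); rewrite (bigD1 i) //= -addrA lerDl addr_ge0 //.
  by apply: sumr_ge0 => j _; exact: gap_term_ge0.
by rewrite mulr_ge0 ?dot_ge0 // invr_ge0 mulr_ge0 ?ltW.
Qed.

Lemma gap_ge_grad x i : (grad f x 0 i - h 0 i) ^+ 2 <= 2 * L * (F x - F xs).
Proof.
rewrite -ler_pdivrMl ?mulr_gt0 //; apply: le_trans (gap_ge x).
rewrite -[leLHS]add0r lerD //.
  by apply: sumr_ge0 => j _; exact: gap_term_ge0.
rewrite ler_wpM2l ?invr_ge0 ?mulr_ge0 ?(ltW L_gt0) //.
by have := sqr_coord_le_dot (grad f x - h) i; rewrite coordB.
Qed.

End ForwardBackward.

(** * Two criteria for convergence to zero *)

Section RealSequences.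
Context {R : realType}.
Implicit Types b c r s : nat -> R.

(** [b] is nonincreasing and bounded below, hence convergent, and its decrements squeeze [c]. *)
Lemma cvg0_decrement b c : (forall k, 0 <= b k) -> (forall k, 0 <= c k) ->
  (forall k, b k.+1 + c k <= b k) -> c @ \oo --> 0.
Proof.
move=> b0 c0 bc.
have /cvg_ex[l bl] : cvgn b.
  apply: nonincreasing_is_cvgn; last by exists 0 => _ [k _ <-].
  by apply/nonincreasing_seqP => k; apply: le_trans (bc k); rewrite lerDl.
have bSl : (fun k => b k.+1) @ \oo --> l by move: bl; rewrite -cvg_shiftS.
have dl : (fun k => b k - b k.+1) @ \oo --> 0 by rewrite -(subrr l); exact: cvgB.
apply: squeeze_cvgr (cvg_cst 0) dl; near=> k.
by rewrite c0 /=; have := bc k; lra.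
Unshelve. all: by end_near.
Qed.

(** The Young parameter is fixed first, to make the term in [B] small; then [k] grows. *)
Lemma cvg0_young r s (B : R) : (forall k, 0 <= r k) -> s @ \oo --> 0 ->
  (forall e k, 0 < e -> r k <= e * B + (1 + e^-1) * s k) -> r @ \oo --> 0.
Proof.
move=> r0 s0 rs; apply/cvgr0Pnorm_lt => e e0.
pose e' := e / 2 / (1 + `|B|).
have B0 : 0 < 1 + `|B| by rewrite ltr_wpDr.
have e'0 : 0 < e' by rewrite !divr_gt0.
have c0 : 0 < 1 + e'^-1 by rewrite addr_gt0 ?invr_gt0.
have /cvgr0Pnorm_lt/(_ _ (divr_gt0 e0 (mulr_gt0 (ltr0n _ 2) c0))) := s0.
apply: filterS => k; rewrite ltr_pdivlMr ?mulr_gt0 // => sk.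
rewrite ger0_norm //; apply: le_lt_trans (rs _ k e'0) _.
have : e' * B < e / 2.
  rewrite /e' mulrAC ltr_pdivrMr // ltr_pM2l ?divr_gt0 //.
  by rewrite (le_lt_trans (ler_norm B)) // ltrDr.
have := ler_wpM2l (ltW c0) (ler_norm (s k)); move: sk; lra.
Qed.

End RealSequences.

(** * Inertial iteration: estimates common to both parameter rules *)

Section Inertial.
Context {R : realType} {n : nat}.
Variables (f : 'rV[R]_n -> R) (L rho : R).
Hypothesis f_convex : convex_function setT f.
Hypothesis f_diff : forall x, differentiable f x.
Hypothesis L_gt0 : 0 < L.
Hypothesis f_lip :
  forall x y, norm2 (grad f x - grad f y) <= L * norm2 (x - y).
Hypothesis rho_gt0 : 0 < rho.
Let F := objective f rho.
Variable xs : 'rV[R]_n.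
Hypothesis xs_min : forall x, F xs <= F x.
(* Indices are shifted: [lam k], [al k], [y k] are the paper's
   lambda_{k+1}, alpha_{k+1}, y^{k+2}. *)
Variables (x : nat -> 'rV[R]_n) (lam al : nat -> R).
Let y k := x k.+1 + al k *: (x k.+1 - x k).
Hypothesis x_rec : forall k, x k.+2 = fb f rho (lam k) (y k).
Hypothesis lam_bnd : forall k, 0 < lam k <= 1 / L.
Hypothesis al_bnd : forall k, 0 <= al k <= 1.

Definition sqdist (u v : 'rV[R]_n) := dot (u - v) (u - v).
Let d k := sqdist (x k.+1) (x k).
Let gap k := F (x k) - F xs.

Let fb_step := fb_ineq f_convex f_diff L_gt0 f_lip rho_gt0.

Let d_ge0 k : 0 <= d k. Proof. exact: dot_ge0. Qed.
Let gap_ge0 k : 0 <= gap k. Proof. by rewrite subr_ge0. Qed.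

(* With [q = x_{k+2} - xs] and [e = y_k - x_{k+2}], the step inequality bounds
   the gap by [2 <q, e> + |e|^2], where [q] is bounded and [e] tends to 0. *)
Lemma gap_cvg0 (lmin B : R) : 0 < lmin -> (forall k, lmin <= lam k) ->
  (forall k, sqdist (x k.+1) xs <= B) -> d @ \oo --> 0 -> gap @ \oo --> 0.
Proof.
move=> l0 lmin_le bnd d0; rewrite -(cvg_shiftn 2).
pose s k := lmin^-1 * (d k + d k.+1).
have s0 : s @ \oo --> 0.
  rewrite -(mulr0 lmin^-1) -[0 in X in _ --> X](addr0 (0 : R)).
  apply: cvgM; first exact: cvg_cst.
  by apply: cvgD => //; move: d0; rewrite -cvg_shiftS.
apply: (cvg0_young (B := (2 * lmin)^-1 * B) _ s0) => [k|e k e0]; first exact: gap_ge0.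
rewrite /= addn2; have := @fb_step (lam k) (y k) xs (lam_bnd k); rewrite -x_rec.
have := bnd k.+1; rewrite -/(sqdist _ xs) -/(sqdist _ xs) -/F /s.
have [/andP[a0 a1] /andP[lk0 _]] := (al_bnd k, lam_bnd k).
pose q := x k.+2 - xs; pose e' := y k - x k.+2.
have -> : sqdist (y k) xs = sqdist (x k.+2) xs + 2 * dot q e' + dot e' e'.
  have -> : sqdist (y k) xs = dot (q + e') (q + e').
    by have -> : q + e' = y k - xs by rewrite /q /e' addrC subrKA.
  by rewrite (dotDl q) !(dotDr _ q) (dotC e' q) -/(sqdist _ xs); ring.
(* [e'] is an inertial part of squared norm at most [d k], as [al k <= 1], minus a step of squared
   norm [d k.+1]. *)
have e'e' : dot e' e' <= 2 * (d k + d k.+1).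
  have -> : e' = al k *: (x k.+1 - x k) - (x k.+2 - x k.+1).
    by rewrite /e' /y opprB addrCA addrA.
  rewrite /d /sqdist; move: (x k.+1 - x k) (x k.+2 - x k.+1) => u v.
  have := dot_ge0 (al k *: u + v); have := dot_ge0 u.
  have : al k ^+ 2 <= 1 by rewrite expr_le1.
  rewrite !dotE (dotC v u) -subr_ge0 => a2 u0.
  by have := mulr_ge0 a2 u0; lra.
have young : 2 * dot q e' <= e * sqdist (x k.+2) xs + e^-1 * dot e' e'.
  exact: dot_young.
move=> qB le_gap; rewrite -(ler_pM2l (mulr_gt0 (ltr0n _ 2) l0)).
have -> : 2 * lmin * (e * ((2 * lmin)^-1 * B) + (1 + e^-1) * (lmin^-1 * (d k + d k.+1)))
  = e * B + (1 + e^-1) * (2 * (d k + d k.+1)) by field; rewrite !gt_eqF.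
have := ler_wpM2r (gap_ge0 k.+2) (lmin_le k).
have e10 : 0 <= 1 + e^-1 by rewrite addr_ge0 // invr_ge0 ltW.
have := ler_wpM2l e10 e'e'; have := ler_wpM2l (ltW e0) qB.
by move: le_gap young; rewrite /gap; lra.
Qed.

(** The step inequality at [z = x_{k+1}], from which [y k] differs by the inertial term alone. *)
Lemma energy k :
  2 * lam k * gap k.+2 + d k.+1 <= 2 * lam k * gap k.+1 + al k ^+ 2 * d k.
Proof.
have := @fb_step (lam k) (y k) (x k.+1) (lam_bnd k); rewrite -x_rec.
have -> : y k - x k.+1 = al k *: (x k.+1 - x k) by rewrite /y addrAC subrr add0r.
rewrite -/(sqdist (x k.+2) (x k.+1)) -/(d k.+1) dotZl dotZr.
by rewrite -/(sqdist (x k.+1) (x k)) -/(d k) /gap -/F; lra.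
Qed.

Lemma sqdist_extrapolation k : sqdist (y k) xs =
  sqdist (x k.+1) xs + al k * (sqdist (x k.+1) xs - sqdist (x k) xs)
    + (al k + al k ^+ 2) * d k.
Proof.
have dE : x k.+1 - x k = (x k.+1 - xs) - (x k - xs) by rewrite opprB subrKA.
have yE : y k - xs = (x k.+1 - xs) + al k *: ((x k.+1 - xs) - (x k - xs)).
  by rewrite -dE /y addrAC.
rewrite /d /sqdist yE dE; move: (x k.+1 - xs) (x k - xs) => u v.
by rewrite !dotE (dotC v u); ring.
Qed.

Lemma fejer k : sqdist (x k.+2) xs <= sqdist (y k) xs.
Proof.
have := @fb_step (lam k) (y k) xs (lam_bnd k); rewrite -x_rec.
have [l0 _] := andP (lam_bnd k).
by have := ler_wpM2l (ltW l0) (gap_ge0 k.+2); rewrite /sqdist /gap -/F; lra.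
Qed.

(** * Nondecreasing step sizes, inertia bounded away from 1 *)

Section NondecreasingSteps.
Variable abar : R.
Hypothesis abar_lt1 : abar < 1.
Hypothesis al_le : forall k, al k <= abar.
Hypothesis lam_incr : forall k, lam k <= lam k.+1.

(** Objective gap plus a kinetic term; [c] below is the rate at which a step of squared length [d k]
    dissipates it. *)
Let en k := gap k.+1 + (2 * lam k)^-1 * d k.
Let c := (1 - abar ^+ 2) * (L / 2).

Let abar_ge0 : 0 <= abar.
Proof. by have /andP[] := al_bnd 0; move: (al_le 0); lra. Qed.

Let c_gt0 : 0 < c.
Proof. by rewrite mulr_gt0 ?divr_gt0 // subr_gt0 expr_lt1. Qed.

(** Divide [energy] by [2 lam k]. Passing to [lam k.+1] only lowers the kinetic coefficient, while
    [al k <= abar] and [1 / (2 lam k) >= L / 2] leave the loss [c d_k]. *)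
Lemma energy_decrease k : en k.+1 + c * d k <= en k.
Proof.
have [/andP[l0 lL] /andP[l1 _]] := (lam_bnd k, lam_bnd k.+1).
have i0 : 0 < (2 * lam k)^-1 by rewrite invr_gt0 mulr_gt0.
have := ler_wpM2l (ltW i0) (energy k).
rewrite !(mulrDr (2 * lam k)^-1 (2 * lam k * gap _)) !(mulrA _ (2 * lam k)).
rewrite mulVf ?mul1r; last first.
  by rewrite gt_eqF ?mulr_gt0.
move=> le_en.
have le_inv : (2 * lam k.+1)^-1 <= (2 * lam k)^-1.
  by rewrite lef_pV2 ?posrE ?mulr_gt0 // ler_pM2l.
have Ll : L / 2 <= (2 * lam k)^-1.
  rewrite -[L / 2]invf_div lef_pV2 ?posrE ?mulr_gt0 ?invr_gt0 //.
  by move: lL; lra.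
have a2 : al k ^+ 2 <= abar ^+ 2.
  by have /andP[a0 _] := al_bnd k; rewrite lerXn2r ?nnegrE.
have := ler_wpM2r (d_ge0 k.+1) le_inv.
have h1 := ler_wpM2r (d_ge0 k) (ler_wpM2l (ltW i0) a2).
have h2 : 0 <= 1 - abar ^+ 2 by rewrite subr_ge0 expr_le1 // ltW.
have := ler_wpM2r (d_ge0 k) (ler_wpM2l h2 Ll).
rewrite /en /c; by move: le_en h1; lra.
Qed.

Lemma nondecreasing_steps_d_cvg0 : d @ \oo --> 0.
Proof.
have c0 k : 0 <= c * d k by rewrite mulr_ge0 ?(ltW c_gt0).
have cd : (fun k => c * d k) @ \oo --> 0.
  apply: (cvg0_decrement (b := en)) => // [k|]; last exact: energy_decrease.
  have /andP[l0 _] := lam_bnd k.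
  by rewrite addr_ge0 // mulr_ge0 // invr_ge0 mulr_ge0 ?(ltW l0).
have -> : d = (fun k => c^-1 * (c * d k)).
  by apply/funext => k; rewrite mulKf ?gt_eqF.
by rewrite -(mulr0 c^-1); apply: cvgM => //; exact: cvg_cst.
Qed.

Lemma nondecreasing_steps_bounded : exists B, forall k, sqdist (x k.+1) xs <= B.
Proof.
(* The positive parts [p] satisfy [p_{k+1} <= abar p_k + 2 d_k]; adding a multiple
   of the energy, which decreases by [c d_k], absorbs the error. *)
pose p k := Num.max 0 (sqdist (x k.+1) xs - sqdist (x k) xs).
pose g k := c * ((1 - abar) * sqdist (x k.+1) xs + abar * p k) + 2 * en k.
have p_ge0 k : 0 <= p k by rewrite /p le_max lexx.
have en_ge0 k : 0 <= en k.
  have /andP[l0 _] := lam_bnd k.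
  by rewrite addr_ge0 // mulr_ge0 // invr_ge0 mulr_ge0 ?(ltW l0).
have g_decr k : g k.+1 <= g k.
  have /andP[a0 a1] := al_bnd k.
  have p1 : p k.+1 <= abar * p k + 2 * d k.
    rewrite {1}/p ge_max addr_ge0 ?mulr_ge0 //=.
    have := fejer k; rewrite sqdist_extrapolation.
    have : al k * (sqdist (x k.+1) xs - sqdist (x k) xs) <= abar * p k.
      apply: (le_trans (ler_wpM2l a0 _) (ler_wpM2r (p_ge0 k) (al_le k))).
      by rewrite /p le_max lexx orbT.
    have : (al k + al k ^+ 2) * d k <= 2 * d k.
      have : al k ^+ 2 <= 1 by rewrite expr_le1.
      by move=> a2; rewrite ler_wpM2r //; lra.
    lra.
  have p2 : sqdist (x k.+2) xs - sqdist (x k.+1) xs <= p k.+1.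
    by rewrite /p le_max lexx orbT.
  have b0 : 0 <= 1 - abar by rewrite subr_ge0 ltW.
  (* The increment of [(1 - abar) |x_{k+1} - xs|^2 + abar p_k] is at most
     [p_{k+1} - abar p_k <= 2 d_k], and [2 en] falls by [2 c d_k]. *)
  have := energy_decrease k; have := ler_wpM2l (ltW c_gt0) p1.
  have := ler_wpM2l (ltW c_gt0) (ler_wpM2l b0 p2); rewrite /g; lra.
have g_le k : g k <= g 0 by elim: k => // k; exact: le_trans.
exists (g 0 / (c * (1 - abar))) => k.
have cb : 0 < c * (1 - abar) by rewrite mulr_gt0 // subr_gt0.
rewrite ler_pdivlMr // mulrC -mulrA; apply: le_trans (g_le k).
rewrite /g mulrDr -addrA lerDl addr_ge0 //; last by rewrite mulr_ge0.
by apply: mulr_ge0; [exact: ltW|rewrite mulr_ge0].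
Qed.

End NondecreasingSteps.

(** * Constant step size, with inertia [al_k = (t_k - 1) / t_{k+1}] *)

Section Nesterov.
Variables (l : R) (t : nat -> R).
Hypothesis lam_const : forall k, lam k = l.
Hypothesis t_ge1 : forall k, 1 <= t k.
Hypothesis t_al : forall k, t k.+1 * al k = t k - 1.
Hypothesis t_rec : forall k, t k.+1 ^+ 2 - t k.+1 <= t k ^+ 2.

(** Equal to [t_{k+1} y_k - (t_{k+1} - 1) x_{k+1} - xs], in which the weighted step inequalities
    telescope. *)
Let u k := x k.+1 - xs + (t k - 1) *: (x k.+1 - x k).

Let l_gt0 : 0 < l. Proof. by have /andP[] := lam_bnd 0; rewrite lam_const. Qed.

Let t_gt0 k : 0 < t k. Proof. exact: lt_le_trans ltr01 (t_ge1 k). Qed.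

(* Combination of the step inequalities at [x_{k+1}] and [xs] with weights
   [t (t - 1)] and [t], where [t = t_{k+1}]. *)
Lemma nesterov_decrease k :
  dot (u k.+1) (u k.+1) + 2 * l * t k.+1 ^+ 2 * gap k.+2
  <= dot (u k) (u k) + 2 * l * t k ^+ 2 * gap k.+1.
Proof.
have s1 := @fb_step (lam k) (y k) (x k.+1) (lam_bnd k).
have s2 := @fb_step (lam k) (y k) xs (lam_bnd k).
move: s1 s2; rewrite -x_rec lam_const -/F => s1 s2.
have uE : u k = x k.+1 - xs + t k.+1 *: (al k *: (x k.+1 - x k)).
  by rewrite /u scalerA t_al.
have yz : y k - x k.+1 = al k *: (x k.+1 - x k).
  by rewrite /y addrAC subrr add0r.
have yxs : y k - xs = x k.+1 - xs + al k *: (x k.+1 - x k) by rewrite /y addrAC.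
(* Now [u k] and [u k.+1] share the base point [x_{k+1} - xs] and the weight [t_{k+1}]. *)
have uSE : u k.+1 = x k.+1 - xs + t k.+1 *: (x k.+2 - x k.+1).
  by apply/rowP => i; rewrite !mxE; ring.
have xxs : x k.+2 - xs = x k.+1 - xs + (x k.+2 - x k.+1) by rewrite [RHS]addrC subrKA.
move: s1 s2; rewrite uE uSE yz yxs xxs.
move: (al k *: _) (x k.+2 - x k.+1) (x k.+1 - xs) => e p q.
rewrite !dotE (dotC p q) (dotC e q) => s1 s2.
have t1 : 0 <= t k.+1 * (t k.+1 - 1) by rewrite mulr_ge0 ?(ltW (t_gt0 _)) // subr_ge0.
have := ler_wpM2l t1 s1; have := ler_wpM2l (ltW (t_gt0 k.+1)) s2.
have l2 : 0 <= 2 * l by rewrite mulr_ge0 // ltW.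
have := ler_wpM2r (gap_ge0 k.+1) (ler_wpM2l l2 (t_rec k)).
by rewrite /gap; lra.
Qed.

Let C := dot (u 0) (u 0) + 2 * l * t 0 ^+ 2 * gap 1.

Let u_le k : dot (u k) (u k) <= C.
Proof.
have : dot (u k) (u k) + 2 * l * t k ^+ 2 * gap k.+1 <= C.
  by elim: k => [|k]; rewrite ?lexx //; apply: le_trans; exact: nesterov_decrease.
apply: le_trans; rewrite lerDl mulr_ge0 ?gap_ge0 //.
by rewrite !mulr_ge0 ?exprn_ge0 ?(ltW l_gt0) ?(ltW (t_gt0 _)).
Qed.

Let B := Num.max C (sqdist (x 1) xs).

(* [x_{k+1} - xs] is the convex combination of [u_k] and [x_k - xs] with weight
   [1 / t_k] on [u_k]. *)
Lemma nesterov_bounded k : sqdist (x k.+1) xs <= B.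
Proof.
elim: k => [|k IH]; first by rewrite /B le_max lexx orbT.
have uB : dot (u k.+1) (u k.+1) <= B by rewrite /B le_max u_le.
have tE : t k.+1 *: (x k.+2 - xs) = u k.+1 + (t k.+1 - 1) *: (x k.+1 - xs).
  by apply/rowP => i; rewrite !mxE; ring.
(* Scaling by [t_{k+1}^2] clears the weights; the convexity defect is then
   [(t_{k+1} - 1) |v - w|^2]. *)
rewrite -(ler_pM2l (exprn_gt0 2 (t_gt0 k.+1))).
have -> : t k.+1 ^+ 2 * sqdist (x k.+2) xs
    = dot (t k.+1 *: (x k.+2 - xs)) (t k.+1 *: (x k.+2 - xs)).
  by rewrite dotZl dotZr mulrA.
rewrite tE; move: IH uB; rewrite /sqdist; move: (u _) (x k.+1 - xs) => v w wB vB.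
have := dot_ge0 (v - w); rewrite !dotE (dotC w v) => vw.
have t1 : 0 <= t k.+1 - 1 by rewrite subr_ge0.
have := mulr_ge0 t1 vw; have := ler_wpM2l (ltW (t_gt0 k.+1)) vB.
have := ler_wpM2l (mulr_ge0 (ltW (t_gt0 k.+1)) t1) wB.
by lra.
Qed.

(** [t_{k+1} (x_{k+2} - x_{k+1})] is the difference of [u k.+1] and [x_{k+1} - xs], both of squared
    norm at most [B]. *)
Lemma nesterov_d_le k : t k.+1 ^+ 2 * d k.+1 <= 4 * B.
Proof.
have -> : t k.+1 ^+ 2 * d k.+1 =
    dot (u k.+1 - (x k.+1 - xs)) (u k.+1 - (x k.+1 - xs)).
  have -> : u k.+1 - (x k.+1 - xs) = t k.+1 *: (x k.+2 - x k.+1).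
    by apply/rowP => i; rewrite !mxE; ring.
  by rewrite dotZl dotZr mulrA.
have : dot (u k.+1) (u k.+1) <= B by rewrite /B le_max u_le.
have := nesterov_bounded k; rewrite /sqdist.
move: (u _) (x k.+1 - xs) => v w wB vB.
by have := dot_ge0 (v + w); rewrite !dotE (dotC w v); lra.
Qed.

End Nesterov.
End Inertial.

(** * Thresholding of a single coordinate: when it gives zero and when it clips *)

Section ActiveCoordinates.
Context {R : realType}.
Implicit Types (b e g h l r t v w z : R).

(* Projection of [v] onto the half-line [{z | - sgn h * z >= 0}]. *)
Definition clip h v : R := if 0 <= h then Num.min v 0 else Num.max v 0.

Lemma clip_sgn h v : 0 <= - sgn h * clip h v.
Proof.
rewrite /sgn /clip; case: ifP => _.
  by rewrite mulN1r oppr_ge0 ge_min lexx orbT.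
by rewrite opprK mul1r le_max lexx orbT.
Qed.

Lemma clip_min h v z : 0 <= - sgn h * z ->
  (clip h v - v) ^+ 2 + (z - clip h v) ^+ 2 <= (z - v) ^+ 2.
Proof.
by rewrite /sgn /clip; case: ifP => _ z0; case: (leP v 0) => v0; nra.
Qed.

Lemma mul_clip h v : `|h| * `|clip h v| = - (h * clip h v).
Proof.
rewrite -normrM ler0_norm //; move: (clip h v) (clip_sgn h v) => c.
rewrite /sgn; case: (leP 0 h) => h0; rewrite ?opprK ?mul1r ?mulN1r ?oppr_ge0 => c0.
  exact: mulr_ge0_le0.
exact: mulr_le0_ge0 (ltW h0) c0.
Qed.

(** The bound on [w] excludes the branch of [soft] with the sign of [h]; the remaining two form a
    clipping. *)
Lemma soft_clip t h w : 0 <= t -> sgn h * w <= t ->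
  soft t w = clip h (w + sgn h * t).
Proof.
move=> t0; rewrite /sgn /soft /clip; case: ifP => _ wt.
  by case: ltP => h1; case: ltP => h2; case: (leP (w + 1 * t) 0) => h3; lra.
by case: ltP => h1; case: ltP => h2; case: (leP (w + -1 * t) 0) => h3; lra.
Qed.

Lemma soft_eq0 t w : `|w| <= t -> soft t w = 0.
Proof.
rewrite ler_norml => /andP[wl wr]; rewrite /soft.
by rewrite !ltNge wl wr.
Qed.

(** The gap term dominates [b |z|], so [v] is small and [|v - l g| <= l rho]. Here [z], [v], [g]
    stand for coordinates of the last iterate, of the extrapolated point and of the gradient
    there. *)
Lemma inactive_radius (lmin rho h : R) : 0 < lmin -> `|h| < rho ->
  exists2 e, 0 < e & forall l z v g, lmin <= l ->
    rho * `|z| + h * z < e -> `|v - z| < e -> `|g - h| < e ->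
    soft (l * rho) (v - l * g) = 0.
Proof.
move=> l0 hr; pose b := rho - `|h|.
have b0 : 0 < b by rewrite subr_gt0.
(* The first entry gives [|g| <= |h| + b / 2], the second [|v| <= l b / 2], for every
   [l >= lmin]. *)
pose e := Num.min (b / 2) (lmin * b ^+ 2 / (2 * (1 + b))).
have b2 : 0 < 2 * (1 + b) by lra.
have e0 : 0 < e.
  by rewrite lt_min divr_gt0 //= divr_gt0 // mulr_gt0 // exprn_gt0.
have e_b : e <= b / 2 by rewrite ge_min lexx.
have e_l : e * (2 * (1 + b)) <= lmin * b ^+ 2.
  by rewrite -ler_pdivlMr // ge_min lexx orbT.
exists e => // l z v g lmin_l hz vz gh; apply: soft_eq0.
have bz : b * `|z| < e.
  apply: le_lt_trans hz; rewrite /b mulrBl lerD2l -normrM.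
  by rewrite lerNl -normrN ler_norm.
have lb : lmin * b <= l * b by rewrite ler_pM2r.
have bv : `|v| <= l * b / 2.
  have v_le : `|v| <= `|z| + e.
    by rewrite -[v](subrK z) (le_trans (ler_normD _ _)) // addrC lerD2l ltW.
  rewrite -(ler_pM2l b0); have := ler_wpM2l (ltW b0) v_le.
  have := ler_wpM2l (ltW b0) lb; rewrite expr2 in e_l; lra.
have g_le : `|g| <= `|h| + b / 2.
  rewrite -[g](subrK h) (le_trans (ler_normD _ _)) // addrC lerD2l.
  by rewrite (le_trans (ltW gh)).
have l_ge0 : 0 <= l by rewrite (le_trans (ltW l0)).
rewrite (le_trans (ler_normB _ _)) // normrM (ger0_norm l_ge0).
by have := ler_wpM2l l_ge0 g_le; move: bv; rewrite /b; lra.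
Qed.

(** The gap term penalizes a [z] with the sign of [h], so [v] can exceed zero only slightly in that
    direction; [g] keeps the sign of [h], and [soft_clip] applies. *)
Lemma active_radius (lmin rho h : R) : 0 < lmin -> 0 < rho -> `|h| = rho ->
  exists2 e, 0 < e & forall l z v g, lmin <= l ->
    rho * `|z| + h * z < e -> `|v - z| < e -> `|g - h| < e ->
    soft (l * rho) (v - l * g) = clip h (v - l * (g - h)).
Proof.
(* [e <= rho] fixes the sign of [g]; the other entry yields [sgn h * v <= l rho]. *)
move=> l0 r0 hr; pose e := Num.min rho (lmin * rho ^+ 2 / (1 + rho)).
have r1 : 0 < 1 + rho by lra.
have e0 : 0 < e by rewrite lt_min r0 divr_gt0 // mulr_gt0 // exprn_gt0.
have e_r : e <= rho by rewrite ge_min lexx.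
have e_l : e * (1 + rho) <= lmin * rho ^+ 2.
  by rewrite -ler_pdivlMr // ge_min lexx orbT.
exists e => // l z v g lmin_l hz vz gh.
have l_gt0 : 0 < l by rewrite (lt_le_trans l0).
have lr : lmin * rho <= l * rho by rewrite ler_pM2r.
have t0 : 0 <= l * rho by rewrite mulr_ge0 ?ltW.
move: gh vz; rewrite !ltr_norml => /andP[g1 g2] /andP[v1 v2].
have := ler_norm z; have := ler_norm (- z); rewrite normrN => z1 z2.
have [[sE hE]|[sE hE]] : (sgn h = 1 /\ h = rho) \/ (sgn h = -1 /\ h = - rho).
  rewrite /sgn; case: (leP 0 h) hr => h0; rewrite ?(ger0_norm h0) ?(ltr0_norm h0).
    by left.
  by right; split=> //; lra.
- rewrite (@soft_clip _ h) // sE; first by congr (clip h _); rewrite hE; ring.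
  have rz : rho * z < e by have := ler_wpM2l (ltW r0) z2; rewrite hE in hz; nra.
  have rv : rho * v <= rho * (l * rho).
    have := ler_wpM2l (ltW r0) (ltW v2); have := ler_wpM2l (ltW r0) lr.
    by rewrite expr2 in e_l; lra.
  rewrite ler_pM2l // in rv.
  have : 0 <= l * g by rewrite mulr_ge0 ?ltW //; rewrite hE in g1; lra.
  lra.
- rewrite (@soft_clip _ h) // sE; first by congr (clip h _); rewrite hE; ring.
  have rz : - (rho * z) < e by have := ler_wpM2l (ltW r0) z1; rewrite hE in hz; nra.
  have rv : rho * - v <= rho * (l * rho).
    have := ler_wpM2l (ltW r0) (ltW v1); have := ler_wpM2l (ltW r0) lr.
    by rewrite expr2 in e_l; lra.
  rewrite ler_pM2l // in rv.
  have : 0 <= l * - g by rewrite mulr_ge0 ?ltW //; rewrite hE in g2; lra.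
  lra.
Qed.

End ActiveCoordinates.

(** * Restriction to the coordinates in [E], the gradient of [phi] and the projection onto the
    orthant *)

Section Restriction.
Context {R : realType} {n : nat}.
Variable E : {set 'I_n}.
Implicit Types (u v : 'rV[R]_n) (w z : 'rV[R]_#|E|).

Lemma ext0_in w (j : 'I_#|E|) : ext0 w 0 (enum_val j) = w 0 j.
Proof.
rewrite mxE (bigD1 j) //= big1 ?addr0 // => k /andP[/eqP jk].
by rewrite (enum_val_inj jk) eqxx.
Qed.

Lemma ext0_notin w i : i \notin E -> ext0 w 0 i = 0.
Proof.
move=> iE; rewrite mxE big1 // => j /eqP ij.
by rewrite -ij enum_valP in iE.
Qed.

Lemma ext0_restr v : (forall i, i \notin E -> v 0 i = 0) -> ext0 (restr E v) = v.
Proof.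
move=> v0; apply/rowP => i; have [iE|iE] := boolP (i \in E); last first.
  by rewrite ext0_notin // v0.
by rewrite -(enum_rankK_in iE iE) ext0_in mxE.
Qed.

Lemma ext0_linear (a : R) w z : ext0 (a *: w + z) = a *: ext0 w + ext0 z.
Proof.
apply/rowP => i; rewrite !mxE big_distrr -big_split; apply: eq_bigr => j _.
by rewrite !mxE.
Qed.

Lemma ext0_delta j : ext0 (delta_mx 0 j : 'rV[R]_#|E|) = delta_mx 0 (enum_val j).
Proof.
apply/rowP => i; have [iE|iE] := boolP (i \in E); last first.
  rewrite ext0_notin // mxE eqxx; case: eqP => // ij.
  by rewrite ij enum_valP in iE.
by rewrite -(enum_rankK_in iE iE) ext0_in !mxE (inj_eq enum_val_inj).
Qed.

Lemma dot_restr u v : dot (restr E u) (restr E v) = \sum_(i in E) u 0 i * v 0 i.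
Proof.
by rewrite [RHS]big_enum_val; apply: eq_bigr => j _; rewrite !mxE.
Qed.

Variables (f : 'rV[R]_n -> R) (h : 'rV[R]_n).
Hypothesis f_diff : forall x, differentiable f x.

(** The difference quotient is a constant linear part plus that of [f] at [ext0 w] along
    [ext0 z]. *)
Lemma is_derive_phi w z : is_derive w z (phi f h (E := E))
  (- dot (restr E h) z + dot (grad f (ext0 w)) (ext0 z)).
Proof.
have lin (a : R) : (phi f h (E := E) \o shift w) (a *: z) - phi f h w =
    a * - dot (restr E h) z + ((f \o shift (ext0 w)) (a *: ext0 z) - f (ext0 w)).
  by rewrite /phi /= ext0_linear dotDr dotZr; ring.
have cv : (fun a : R => a^-1 *: ((phi f h (E := E) \o shift w) (a *: z)
    - phi f h w)) @ 0^' -->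
    - dot (restr E h) z + dot (grad f (ext0 w)) (ext0 z).
  apply: (@cvg_trans _ ((fun a : R => - dot (restr E h) z
      + a^-1 *: ((f \o shift (ext0 w)) (a *: ext0 z) - f (ext0 w))) @ 0^')).
    apply: near_eq_cvg; near=> a.
    have a0 : a != 0 by near: a; exact: nbhs_dnbhs_neq.
    rewrite lin [RHS]scalerDr; congr (_ + _).
    by rewrite -[RHS]/(a^-1 * (a * _)) mulKf.
  apply: cvgD; first exact: cvg_cst.
  by rewrite -derive_dot_grad //; exact: diff_derivable.
apply: DeriveDef; last exact: cvg_lim.
by apply/cvg_ex; eexists; exact: cv.
Unshelve. all: by end_near.
Qed.

Lemma grad_phi w :
  grad (phi f h (E := E)) w = - restr E h + restr E (grad f (ext0 w)).
Proof.
apply/rowP => j; rewrite mxE.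
have [_ ->] := is_derive_phi w (delta_mx 0 j).
rewrite ext0_delta -derive_dot_grad // !mxE; congr (- _ + _).
by rewrite dot_delta mxE.
Qed.

Lemma objective_restr (rho : R) v :
  (forall i, i \notin E -> v 0 i = 0) ->
  (forall i, i \in E -> rho * `|v 0 i| = - (h 0 i * v 0 i)) ->
  objective f rho v = phi f h (restr E v).
Proof.
move=> v0 vE; rewrite /objective /phi ext0_restr // addrC dot_restr; congr (_ + _).
rewrite /norm1 mulr_sumr (bigID (mem E)) /= [X in _ + X]big1 ?addr0; last first.
  by move=> i /v0 ->; rewrite normr0 mulr0.
by rewrite -sumrN; apply: eq_bigr => i; exact: vE.
Qed.

(** The orthant is a product of half-lines; summing [clip_min] over coordinates gives minimality and
    uniqueness together. *)
Lemma proj_orthant w :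
  proj (orthant h E) w = \row_j clip (restr E h 0 j) (w 0 j).
Proof.
set p := RHS.
have pE j : p 0 j = clip (restr E h 0 j) (w 0 j) by rewrite [LHS]mxE.
have pO : orthant h E p by move=> j; rewrite pE clip_sgn.
have pP z : orthant h E z -> dot (p - w) (p - w) + dot (z - p) (z - p)
    <= dot (z - w) (z - w).
  move=> zP; rewrite /dot -big_split; apply: ler_sum => j _ /=.
  by rewrite !coordB pE -!expr2; exact/clip_min/zP.
apply: get_unique => [|z [zP z_min]].
  split=> // z zP.
  by rewrite ler_wsqrtr // (le_trans _ (pP _ zP)) // lerDl dot_ge0.
apply: dot_le0_eq; have := pP z zP; have := z_min _ pO.
rewrite ler_sqrt ?dot_ge0 //; lra.
Qed.
End Restriction.

(** * Identification of support and signs after finitely many steps *)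

Section Identification.
Context {R : realType} {n : nat}.
Variables (f : 'rV[R]_n -> R) (L rho : R).
Hypothesis f_convex : convex_function setT f.
Hypothesis f_diff : forall x, differentiable f x.
Hypothesis L_gt0 : 0 < L.
Hypothesis f_lip :
  forall x y, norm2 (grad f x - grad f y) <= L * norm2 (x - y).
Hypothesis rho_gt0 : 0 < rho.
Variable xs : 'rV[R]_n.
Hypothesis xs_min : forall x, objective f rho xs <= objective f rho x.
Variables (x : nat -> 'rV[R]_n) (lam al : nat -> R).
Let y k := x k.+1 + al k *: (x k.+1 - x k).
Hypothesis x_rec : forall k, x k.+2 = fb f rho (lam k) (y k).
Hypothesis al_bnd : forall k, 0 <= al k <= 1.
Variable lmin : R.
Hypothesis lmin_gt0 : 0 < lmin.
Hypothesis lmin_le : forall k, lmin <= lam k.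
Let d k := sqdist (x k.+1) (x k).
Let gap k := objective f rho (x k) - objective f rho xs.
Hypothesis gap0 : gap @ \oo --> 0.
Hypothesis d0 : d @ \oo --> 0.
Let h := grad f xs.
Let E := active h rho.

Let gap_ge0 k : 0 <= gap k. Proof. by rewrite subr_ge0. Qed.
Let d_ge0 k : 0 <= d k. Proof. exact: dot_ge0. Qed.

Lemma sqr_coord_step k i : (y k 0 i - x k.+1 0 i) ^+ 2 <= d k.
Proof.
have -> : y k 0 i - x k.+1 0 i = al k * (x k.+1 - x k) 0 i.
  by rewrite /y !mxE; ring.
have /andP[a0 a1] := al_bnd k.
have := sqr_coord_le_dot (x k.+1 - x k) i; rewrite -/(sqdist _ _) -/(d k).
by rewrite exprMn => /(le_trans _)->//; rewrite ler_piMl ?sqr_ge0 // expr_le1.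
Qed.

(** Pass through the gradient at [x k.+1]: the Lipschitz bound controls one difference, the
    objective gap the other. *)
Lemma sqr_coord_grad k i :
  (grad f (y k) 0 i - h 0 i) ^+ 2 <= 2 * L ^+ 2 * d k + 4 * L * gap k.+1.
Proof.
have : (grad f (y k) 0 i - grad f (x k.+1) 0 i) ^+ 2 <= L ^+ 2 * d k.
  have := sqr_coord_le_dot (grad f (y k) - grad f (x k.+1)) i.
  rewrite coordB -norm2_sqr => /le_trans-> //.
  have lip := f_lip (y k) (x k.+1).
  rewrite (le_trans (lerXn2r 2 _ _ lip)) ?nnegrE ?sqrtr_ge0 //.
    by rewrite mulr_ge0 ?sqrtr_ge0 // ltW.
  have -> : y k - x k.+1 = al k *: (x k.+1 - x k).
    by rewrite /y addrAC subrr add0r.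
  rewrite exprMn norm2_sqr dotZl dotZr -/(sqdist _ _) -/(d k).
  rewrite ler_wpM2l ?exprn_ge0 ?(ltW L_gt0) // mulrA -expr2.
  by have /andP[a0 a1] := al_bnd k; rewrite ler_piMl // expr_le1.
have := gap_ge_grad f_convex f_diff L_gt0 f_lip rho_gt0 xs_min (x k.+1) i.
rewrite -/h -/(gap k.+1); move: (grad f (y k) 0 i) (grad f (x k.+1) 0 i) => a b.
have := sqr_ge0 ((a - b) - (b - h 0 i)); rewrite !expr2; lra.
Qed.

(** Supplies the smallness hypotheses of [inactive_radius] and [active_radius]. *)
Lemma near_small (e : R) : 0 < e -> \forall k \near \oo, forall i,
  [/\ rho * `|x k.+1 0 i| + h 0 i * x k.+1 0 i < e,
      `|y k 0 i - x k.+1 0 i| < e & `|grad f (y k) 0 i - h 0 i| < e].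
Proof.
move=> e0.
have w0 : (fun k => 2 * L ^+ 2 * d k + 4 * L * gap k.+1) @ \oo --> 0.
  rewrite -[0 in X in _ --> X](addr0 (0 : R)).
  apply: cvgD.
    by rewrite -(mulr0 (2 * L ^+ 2)); apply: cvgM => //; exact: cvg_cst.
  rewrite -(mulr0 (4 * L)); apply: cvgM; first exact: cvg_cst.
  by move: gap0; rewrite -cvg_shiftS.
have e2 : 0 < e ^+ 2 by rewrite exprn_gt0.
have sqr_lt (a : R) : a ^+ 2 < e ^+ 2 -> `|a| < e.
  by rewrite -[a ^+ 2]real_normK ?num_real // ltr_pXn2r ?nnegrE ?(ltW e0).
have gapS : (fun k => gap k.+1) @ \oo --> 0 by move: gap0; rewrite -cvg_shiftS.
move/cvgr0Pnorm_lt : w0 => /(_ _ e2); move/cvgr0Pnorm_lt : d0 => /(_ _ e2).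
move/cvgr0Pnorm_lt : gapS => /(_ _ e0); apply: filterS3 => k + + + i.
rewrite (ger0_norm (gap_ge0 _)) (ger0_norm (d_ge0 _)) => g1 d1 w1.
split.
  apply: le_lt_trans g1.
  exact: (gap_ge_coord f_convex f_diff L_gt0 f_lip rho_gt0 xs_min).
  by apply: sqr_lt; exact: le_lt_trans (sqr_coord_step k i) d1.
apply: sqr_lt; apply: le_lt_trans (sqr_coord_grad k i) (le_lt_trans (ler_norm _) w1).
Qed.

Lemma identification : \forall k \near \oo, forall i, x k.+2 0 i =
  if i \in E then clip (h 0 i) (y k 0 i - lam k * (grad f (y k) 0 i - h 0 i))
  else 0.
Proof.
apply: filter_forall => i.
have xE k : x k.+2 0 i = soft (lam k * rho) (y k 0 i - lam k * grad f (y k) 0 i).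
  by rewrite x_rec [LHS]mxE coordB coordZ.
rewrite /E inE; case: eqP => hi.
  have [e e0 eP] := active_radius lmin_gt0 rho_gt0 hi.
  by apply: filterS (near_small e0) => k /(_ i)[? ? ?]; rewrite xE (eP _ (x k.+1 0 i)).
have [hi_le _] := minimizer_kkt f_convex f_diff L_gt0 f_lip rho_gt0 xs_min i.
have {}hi : `|h 0 i| < rho by rewrite lt_neqAle hi_le andbT; exact/eqP.
have [e e0 eP] := inactive_radius lmin_gt0 hi.
by apply: filterS (near_small e0) => k /(_ i)[? ? ?]; rewrite xE (eP _ (x k.+1 0 i)).
Qed.

Lemma eventually_projected : \forall k \near \oo,
  restr E (x k.+2) =
    proj (orthant h E)
      (restr E (y k) - lam k *: grad (phi f h (E := E)) (restr E (y k)))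
  /\ objective f rho (x k.+1) = phi f h (restr E (x k.+1)).
Proof.
have [N _ idN] := identification.
(* The offset 2 makes [x k] and [x k.+1] already identified, so [y k] vanishes off [E] and is
   recovered from its restriction. *)
exists N.+2 => // -[|[|k]] // Nk.
have /= id0 := idN k Nk; have /= id1 := idN k.+1 (leqW Nk).
have /= id2 := idN k.+2 (leqW (leqW Nk)).
have supp j i : (N <= j)%N -> i \notin E -> x j.+2 0 i = 0.
  by move=> /idN/(_ i) -> /negPf ->.
have y_supp i : i \notin E -> y k.+2 0 i = 0.
  by move=> iE; rewrite /y !mxE !supp // ?leqW //; ring.
split.
  apply/rowP => j; rewrite proj_orthant mxE id2 enum_valP [RHS]mxE.
  rewrite grad_phi // ext0_restr //; congr clip; rewrite !mxE; ring.
apply: objective_restr => [i iE|i iE]; first by rewrite supp // leqW.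
have := iE; rewrite inE => /eqP <-.
by rewrite id1 iE mul_clip.
Qed.

End Identification.

(** * Both parameter rules reduced to the identification result *)

Theorem theorem3 (R : realType) (n : nat) (f : 'rV[R]_n -> R) (L rho : R)
  (f_convex : convex_function setT f)
  (f_diff : forall x, differentiable f x)
  (L_gt0 : 0 < L)
  (f_lip : forall x y, norm2 (grad f x - grad f y) <= L * norm2 (x - y))
  (rho_gt0 : 0 < rho)
  (Fstar_finite : (-oo < optval f rho)%E)
  (Xstar_nonempty : optset f rho !=set0)
  (h : 'rV[R]_n)
  (h_grad : forall z, optset f rho z -> grad f z = h)
  (x y : nat -> 'rV[R]_n) (lambda alpha : nat -> R)
  (y_def : forall k, (1 <= k)%N ->
     y k.+1 = x k + alpha k *: (x k - x k.-1))
  (x_def : forall k, (1 <= k)%N ->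
     x k.+1 = prox (fun z => lambda k * rho * norm1 z)
                   (y k.+1 - lambda k *: grad f (y k.+1)))
  (params :
     [/\ forall k, (1 <= k)%N -> lambda k <= lambda k.+1,
         forall k, (1 <= k)%N -> 0 < lambda k <= 1 / L
       & exists2 abar : R, abar < 1 &
           forall k, (1 <= k)%N -> 0 <= alpha k <= abar]
     \/
     x 1%N = x 0%N /\
     exists lam a : R,
       [/\ 0 < lam <= 1 / L, 2 < a
         & forall k, (1 <= k)%N ->
             lambda k = lam /\ alpha k = (k%:R - 1) / (k%:R + a)]) :
  let E := active h rho in
  \forall k \near \oo,
    restr E (x k.+1) =
      proj (orthant h E)
        (restr E (y k.+1) - lambda k *: grad (phi f h (E := E)) (restr E (y k.+1)))
    /\ objective f rho (x k) = phi f h (restr E (x k)).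
Proof.
move=> E.
have [xs xs_opt] := Xstar_nonempty.
have xs_min z := optset_minimizes z xs_opt.
rewrite /E -(h_grad _ xs_opt) => {E h h_grad}.
pose lam k := lambda k.+1; pose al k := alpha k.+1.
have yE k : y k.+2 = x k.+1 + al k *: (x k.+1 - x k) by exact: y_def.
have lam_bnd k : 0 < lam k <= 1 / L.
  case: params => [[_ lam_bnd _]|[_ [l [a [l_bnd _ la]]]]]; first exact: lam_bnd.
  by rewrite /lam; have [-> _] := la k.+1 isT.
have al_bnd k : 0 <= al k <= 1.
  case: params => [[_ _ [abar abar1 al_bnd]]|[_ [l [a [_ a2 la]]]]].
    have /andP[a0 a1] := al_bnd k.+1 isT.
    by rewrite /al a0 (le_trans a1) // ltW.
  have ka : 0 < k.+1%:R + a by rewrite addr_gt0 // (lt_trans _ a2).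
  rewrite /al; have [_ ->] := la k.+1 isT.
  rewrite ler_pdivlMr // ler_pdivrMr // mul0r mul1r.
  by rewrite -natr1 addrK ler0n /=; lra.
have x_rec k : x k.+2 = fb f rho (lam k) (x k.+1 + al k *: (x k.+1 - x k)).
  have /andP[l0 _] := lam_bnd k.
  by rewrite -yE x_def // prox_norm1 // mulr_ge0 ?(ltW l0) ?(ltW rho_gt0).
have [lmin l0 lmin_le] : exists2 lmin, 0 < lmin & forall k, lmin <= lam k.
  exists (lam 0); first by have /andP[] := lam_bnd 0.
  case: params => [[lam_incr _ _]|[_ [l [a [_ _ la]]]]] k.
    by elim: k => // k IH; apply: le_trans IH _; exact: lam_incr.
  by rewrite /lam; have [-> _] := la k.+1 isT; have [-> _] := la 1 isT.
have [[B bnd] d0] : (exists B, forall k, sqdist (x k.+1) xs <= B) /\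
    (fun k => sqdist (x k.+1) (x k)) @ \oo --> 0.
  case: params => [[lam_incr _ [abar abar1 al_le]]|[_ [l [a [_ a2 la]]]]].
    have {}al_le k : al k <= abar by have /andP[] := al_le k.+1 isT.
    have {}lam_incr k : lam k <= lam k.+1 by exact: lam_incr.
    split.
      exact: (nondecreasing_steps_bounded f_convex f_diff L_gt0 f_lip rho_gt0
        xs_min x_rec lam_bnd al_bnd abar1 al_le lam_incr).
    exact: (nondecreasing_steps_d_cvg0 f_convex f_diff L_gt0 f_lip rho_gt0
      xs_min x_rec lam_bnd al_bnd abar1 al_le lam_incr).
  (* Solves [t_{k+1} al_k = t_k - 1] for [al_k = k / (k + 1 + a)]; the increments are [1 / a], and
     [a > 2] gives [t_rec]. *)
  pose t k : R := (k%:R + a) / a.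
  have a0 : 0 < a by rewrite (lt_trans _ a2).
  have ka k : 0 < k%:R + a by rewrite ltr_wpDl.
  have lamE k : lam k = l by have [] := la k.+1 isT.
  have t1 k : 1 <= t k by rewrite ler_pdivlMr // mul1r lerDr.
  have t_al k : t k.+1 * al k = t k - 1.
    rewrite /t /al; have [_ ->] := la k.+1 isT.
    by have := ka k.+1; rewrite -natr1 => kSa; field; rewrite !gt_eqF.
  have t_rec k : t k.+1 ^+ 2 - t k.+1 <= t k ^+ 2.
    have -> : t k.+1 = t k + a^-1 by rewrite /t -natr1; field; rewrite gt_eqF.
    have c0 : 0 < a^-1 by rewrite invr_gt0.
    have c1 : 2 * a^-1 <= 1 by rewrite ler_pdivrMr // mul1r ltW.
    by have := t1 k; nra.
  have bnd := nesterov_bounded f_convex f_diff L_gt0 f_lip rho_gt0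
    xs_min x_rec lam_bnd lamE t1 t_al t_rec.
  have d_le := nesterov_d_le f_convex f_diff L_gt0 f_lip rho_gt0
    xs_min x_rec lam_bnd lamE t1 t_al t_rec.
  split; first by eexists; exact: bnd.
  have [B {}d_le] : exists B, forall k, t k.+1 ^+ 2 * sqdist (x k.+2) (x k.+1) <= B.
    by eexists; exact: d_le.
  suff : (fun k => sqdist (x k.+2) (x k.+1)) @ \oo --> 0.
    by move=> dS; rewrite -cvg_shiftS; exact: dS.
  (* As [t_{k+1} = (k + 1 + a) / a], squared steps are [O(1 / k^2)]; the weaker harmonic bound
     suffices. *)
  have hB : (fun k => B * a ^+ 2 * harmonic k) @ \oo --> 0.
    rewrite -(mulr0 (B * a ^+ 2)); apply: cvgM; first exact: cvg_cst.
    exact: cvg_harmonic.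
  apply: squeeze_cvgr (cvg_cst 0) hB; near=> k; rewrite dot_ge0 /=.
  rewrite /harmonic ler_pdivlMr ?ltr0n // (le_trans _ (ler_wpM2r _ (d_le k))) ?sqr_ge0 //.
  rewrite mulrC mulrAC ler_wpM2r ?dot_ge0 // -exprMn /t divfK ?gt_eqF //.
  have : 1 <= k.+1%:R :> R by rewrite ler1n.
  nra.
have gap0 := gap_cvg0 f_convex f_diff L_gt0 f_lip rho_gt0 xs_min x_rec
  lam_bnd al_bnd l0 lmin_le bnd d0.
have [N _ NP] := eventually_projected f_convex f_diff L_gt0 f_lip rho_gt0 xs_min
  x_rec al_bnd l0 lmin_le gap0 d0.
(* The claim at [k.+1] is the shifted statement at [k]; the bound excludes index 0. *)
exists N.+1 => // -[|k] // Nk.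
by rewrite yE; exact: NP.
Unshelve. all: by end_near.
Qed.
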